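(* For the $T^2$-action on the nearly Kähler complex projective space $\mathbb{CP}^3=\mathrm{Sp}(2)/\mathrm{Sp}(1)\mathrm{U}(1)$ with multi-moment map $\nu_{\mathbb{CP}^3}$ described in the context, there are exactly two $T^2$-orbits of critical points where $\nu_{\mathbb{CP}^3}$ does not vanish. Thus they give the maximum and minimum of $\nu_{\mathbb{CP}^3}$.
   Context: $\mathrm{Sp}(2)$ is the group of $2\times2$ quaternionic matrices $p$ with $p^{-1}=\overline{p}^{t}$; $\mathrm{Sp}(1)\mathrm{U}(1)\subset\mathrm{Sp}(2)$ is the subgroup of matrices $\mathrm{diag}(e^{i\vartheta},\alpha)$ with $\alpha$ a unit quaternion, and $\mathbb{CP}^3\cong\mathrm{Sp}(2)/\mathrm{Sp}(1)\mathrm{U}(1)$ (from the transitive action of $\mathrm{Sp}(2)$ on $\mathbb{CP}^3$ induced by $\mathbb{C}^4\cong\mathbb{H}^2$). Nearly Kähler structure: $\mathfrak{sp}(2)=\mathfrak{h}\oplus\mathfrak{m}$, with $\mathfrak{h}$ the Lie algebra of $\mathrm{Sp}(1)\mathrm{U}(1)$ and $\mathfrak{m}$ the matrices $\begin{pmatrix} xj & \rho\\ -\overline{\rho} & 0\end{pmatrix}$, $x\in\mathbb{C}$, $\rho\in\mathbb{H}$. On $\mathfrak{m}$ put $g_0(X,Y)=\mathrm{Re}\,\mathrm{Tr}(\overline{X}^{t}Y)$, $J_0X=\tfrac{2}{\sqrt3}\bigl(AXA^{-1}+\tfrac12X\bigr)$ with $A=\mathrm{diag}(e^{2\pi i/3},1)$,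 and $\sigma_0=g_0(J_0\cdot,\cdot)$; these are extended by left translation to $\mathrm{Sp}(2)$-invariant tensors on $\mathrm{Sp}(2)/\mathrm{Sp}(1)\mathrm{U}(1)$. The torus $T^2=\{\mathrm{diag}(e^{i\vartheta},e^{i\varphi})\}\subset\mathrm{Sp}(2)$ acts by left multiplication. With $U=\mathrm{diag}(i,0)$, $V=\mathrm{diag}(0,i)$, the multi-moment map at the coset of $p$ is $\nu_{\mathbb{CP}^3}(p)=\sigma_0\bigl((p^{-1}Up)_{\mathfrak{m}},(p^{-1}Vp)_{\mathfrak{m}}\bigr)$ (subscript $\mathfrak{m}$: projection onto $\mathfrak{m}$). Writing $p_{ik}=p_{ik}^1+p_{ik}^2j$ with $p_{ik}^1,p_{ik}^2\in\mathbb{C}$, it is the $T^2$-invariant smooth function $12\,\mathrm{Im}(\overline{p}_{11}^1p_{11}^2p_{21}^1\overline{p}_{21}^2)$. A point is critical if $d\nu_{\mathbb{CP}^3}$ vanishes there. *)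

(* Defs.v *)
From HB Require Import structures.
From mathcomp Require Import all_boot all_order all_algebra.
From mathcomp Require Import generic_quotient.
From mathcomp Require Import all_classical all_reals all_analysis.
From mathcomp Require Import complex.
From mathcomp Require Import ring.

Set Implicit Arguments.
Unset Strict Implicit.
Unset Printing Implicit Defensive.

Import Order.TTheory GRing.Theory Num.Theory.
Import numFieldNormedType.Exports.

Local Open Scope ring_scope.
Local Open Scope quotient_scope.
Local Open Scope classical_set_scope.

(* The quaternion z + w j is encoded by the pair (z, w) of complex numbers;
   j z = conj(z) j for z complex. *)
Record quat (R : Type) := Quat { qfst : R[i]; qsnd : R[i] }.

Section QuaternionRing.
Variable R : rcfType.
Implicit Types p q : quat R.

Definition pair_of_quat q := (qfst q, qsnd q).
Definition quat_of_pair (u : R[i] * R[i]) := Quat u.1 u.2.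
Lemma pair_of_quatK : cancel pair_of_quat quat_of_pair.
Proof. by case. Qed.

HB.instance Definition _ := Equality.copy (quat R) (can_type pair_of_quatK).
HB.instance Definition _ := Choice.copy (quat R) (can_type pair_of_quatK).

Definition qadd p q := Quat (qfst p + qfst q) (qsnd p + qsnd q).
Definition qopp q := Quat (- qfst q) (- qsnd q).
Definition qmul p q :=
  Quat (qfst p * qfst q - qsnd p * conjc (qsnd q))
       (qfst p * qsnd q + qsnd p * conjc (qfst q)).
Definition qconj q := Quat (conjc (qfst q)) (- qsnd q).
Definition qre q : R := complex.Re (qfst q).

Fact qaddA : associative qadd.
Proof. by move=> ? ? ?; rewrite /qadd /= !addrA. Qed.
Fact qaddC : commutative qadd.
Proof. by move=> p q; congr Quat; rewrite addrC. Qed.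
Fact qadd0 : left_id (Quat 0 0) qadd.
Proof. by case=> a b; rewrite /qadd /= !add0r. Qed.
Fact qaddN : left_inverse (Quat 0 0) qopp qadd.
Proof. by case=> a b; rewrite /qadd /= !addNr. Qed.

HB.instance Definition _ :=
  GRing.isZmodule.Build (quat R) qaddA qaddC qadd0 qaddN.

Fact qmulA : associative qmul.
Proof.
by move=> p q r; rewrite /qmul /= !(rmorphB, rmorphD, rmorphM) /= !conjcK;
   congr Quat; ring.
Qed.
Fact qmul1 : left_id (Quat 1 0) qmul.
Proof. by case=> a b; rewrite /qmul /= !(mul1r, mul0r, subr0, addr0). Qed.
Fact qmulr1 : right_id (Quat 1 0) qmul.
Proof.
case=> [[a b] [c d]]; rewrite /qmul /=.
by congr (Quat (_ +i* _)%C (_ +i* _)%C); ring.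
Qed.
Fact qmulDl : left_distributive qmul qadd.
Proof. by move=> p q r; rewrite /qmul /qadd /=; congr Quat; ring. Qed.
Fact qmulDr : right_distributive qmul qadd.
Proof.
by move=> p q r; rewrite /qmul /qadd /= !rmorphD /=; congr Quat; ring.
Qed.
Fact qone_neq0 : Quat 1 0 != 0 :> quat R.
Proof. by apply/eqP=> -[/eqP]; rewrite oner_eq0. Qed.

HB.instance Definition _ := GRing.Zmodule_isNzRing.Build (quat R)
  qmulA qmul1 qmulr1 qmulDl qmulDr qone_neq0.

Lemma qaddE p q : p + q = Quat (qfst p + qfst q) (qsnd p + qsnd q).
Proof. by []. Qed.
Lemma qoppE p : - p = Quat (- qfst p) (- qsnd p).
Proof. by []. Qed.
Lemma qmulE p q : p * q =
  Quat (qfst p * qfst q - qsnd p * conjc (qsnd q))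
       (qfst p * qsnd q + qsnd p * conjc (qfst q)).
Proof. by []. Qed.
Lemma q0E : 0 = Quat 0 0 :> quat R.
Proof. by []. Qed.
Lemma q1E : 1 = Quat 1 0 :> quat R.
Proof. by []. Qed.

Lemma qconjD p q : qconj (p + q) = qconj p + qconj q.
Proof. by rewrite /qconj !qaddE /= rmorphD opprD. Qed.
Lemma qconjN p : qconj (- p) = - qconj p.
Proof. by rewrite /qconj !qoppE /= rmorphN. Qed.
Lemma qconj0 : qconj 0 = 0.
Proof. by congr (Quat (_ +i* _)%C (_ +i* _)%C); rewrite /= oppr0. Qed.
Lemma qconj1 : qconj 1 = 1.
Proof. by congr (Quat (_ +i* _)%C (_ +i* _)%C); rewrite /= oppr0. Qed.
Lemma qconjK : involutive qconj.
Proof. by case=> a b; rewrite /qconj /= conjcK opprK. Qed.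
Lemma qconjM p q : qconj (p * q) = qconj q * qconj p.
Proof.
rewrite /qconj !qmulE /= !(rmorphB, rmorphN, rmorphM) /= !conjcK.
by congr Quat; ring.
Qed.

Lemma qreD p q : qre (p + q) = qre p + qre q.
Proof. by case: p q => [[a b] c] [[d e] f]. Qed.
Lemma qreC p q : qre (p * q) = qre (q * p).
Proof.
by case: p q => [[a b] [c d]] [[a' b'] [c' d']]; rewrite /qre /=; ring.
Qed.

Definition qreal (r : R) : quat R := Quat r%:C%C 0.
Lemma qrealC r q : qreal r * q = q * qreal r.
Proof.
case: q => [[a b] [c d]]; rewrite /qreal !qmulE /=.
by congr (Quat (_ +i* _)%C (_ +i* _)%C); ring.
Qed.

Lemma qunit_comm q : qconj q * q = 1 -> q * qconj q = 1.
Proof.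
move=> h; have -> : q * qconj q = qconj q * q; last by [].
case: q {h} => [z w]; rewrite !qmulE /= rmorphN /= !conjcK.
by congr Quat; ring.
Qed.

End QuaternionRing.

Section QuaternionMatrices.
Variable R : rcfType.
Implicit Types X Y : 'M[quat R]_2.

Definition mat2 (a b c d : quat R) : 'M[quat R]_2 :=
  \matrix_(i, j) if i == 0 then (if j == 0 then a else b)
                 else (if j == 0 then c else d).
Definition diag2 (a d : quat R) := mat2 a 0 0 d.

Definition conjtr X : 'M[quat R]_2 := (map_mx (@qconj R) X)^T.

Lemma ord2P (P : 'I_2 -> Prop) : P 0 -> P 1 -> forall i, P i.
Proof.
move=> P0 P1 [[|[|i]] lti] //; first by have <- : 0 = Ordinal lti by apply: val_inj.
by have <- : 1 = Ordinal lti by apply: val_inj.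
Qed.
Lemma mat2_eta X : X = mat2 (X 0 0) (X 0 1) (X 1 0) (X 1 1).
Proof.
by apply/matrixP; apply: ord2P; apply: ord2P; rewrite !mxE.
Qed.
Lemma mul_mat2 a b c d a' b' c' d' :
  mat2 a b c d *m mat2 a' b' c' d' =
  mat2 (a * a' + b * c') (a * b' + b * d') (c * a' + d * c') (c * b' + d * d').
Proof.
by apply/matrixP; apply: ord2P; apply: ord2P;
   rewrite !mxE !big_ord_recl big_ord0 !mxE /= addr0.
Qed.
Lemma conjtr_mat2 a b c d :
  conjtr (mat2 a b c d) = mat2 (qconj a) (qconj c) (qconj b) (qconj d).
Proof. by apply/matrixP; apply: ord2P; apply: ord2P; rewrite !mxE. Qed.
Lemma mat2_1 : 1%:M = mat2 1 0 0 1.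
Proof. by apply/matrixP; apply: ord2P; apply: ord2P; rewrite !mxE. Qed.

Lemma conjtrM X Y : conjtr (X *m Y) = conjtr Y *m conjtr X.
Proof.
rewrite (mat2_eta X) (mat2_eta Y) !(mul_mat2, conjtr_mat2).
by rewrite !(qconjD, qconjM).
Qed.
Lemma conjtrK : involutive conjtr.
Proof. by move=> X; rewrite (mat2_eta X) !conjtr_mat2 !qconjK. Qed.
Lemma conjtr1 : conjtr 1%:M = 1%:M.
Proof. by rewrite mat2_1 conjtr_mat2 qconj1 qconj0. Qed.

Lemma qre_mxtraceC X Y : qre (\tr (X *m Y)) = qre (\tr (Y *m X)).
Proof.
rewrite (mat2_eta X) (mat2_eta Y) !mul_mat2 /mxtrace !big_ord_recl !big_ord0.
rewrite !mxE /= !addr0 !qreD [LHS]addrACA [RHS]addrACA.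
rewrite (qreC (X 0 0)) (qreC (X 0 1)) (qreC (X 1 0)) (qreC (X 1 1)).
ring.
Qed.

Lemma mulmx_qreal r X Y : X *m (qreal r *: Y) = qreal r *: (X *m Y).
Proof.
apply/matrixP => i j; rewrite !mxE mulr_sumr; apply: eq_bigr => k _.
by rewrite mxE mulrA -qrealC mulrA.
Qed.

Definition is_Sp2 (p : 'M[quat R]_2) : bool :=
  (p *m conjtr p == 1%:M) && (conjtr p *m p == 1%:M).

Record Sp2 := MkSp2 { sp2mx :> 'M[quat R]_2; sp2P : is_Sp2 sp2mx }.
HB.instance Definition _ := [isSub for sp2mx].
HB.instance Definition _ := [Choice of Sp2 by <:].

Lemma sp2_mulV (p : Sp2) : p *m conjtr p = 1%:M.
Proof. by have /andP[/eqP] := sp2P p. Qed.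
Lemma sp2_mulVl (p : Sp2) : conjtr p *m p = 1%:M.
Proof. by have /andP[_ /eqP] := sp2P p. Qed.

Lemma sp2_mul_subproof (p q : Sp2) : is_Sp2 (p *m q).
Proof.
rewrite /is_Sp2 conjtrM -mulmxA (mulmxA (sp2mx q)) sp2_mulV mul1mx sp2_mulV.
by rewrite -mulmxA (mulmxA _ (sp2mx p)) sp2_mulVl mul1mx sp2_mulVl !eqxx.
Qed.
Definition sp2_mul (p q : Sp2) := MkSp2 (sp2_mul_subproof p q).

End QuaternionMatrices.

Section ProjectiveSpace.
Variable R : realType.
Local Notation M := 'M[quat R]_2.

Definition expi (t : R) : quat R := Quat (cos t +i* sin t)%C 0.

Lemma expiD s t : expi (s + t) = expi s * expi t.
Proof.
rewrite /expi qmulE /= cosD sinD.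
by congr (Quat (_ +i* _)%C (_ +i* _)%C); ring.
Qed.
Lemma expi0 : expi 0 = 1.
Proof. by rewrite /expi cos0 sin0. Qed.
Lemma qconj_expi t : qconj (expi t) = expi (- t).
Proof. by rewrite /expi /qconj /= cosN sinN oppr0. Qed.
Lemma expiC s t : expi s * expi t = expi t * expi s.
Proof. by rewrite -!expiD addrC. Qed.

(* Sp(1)U(1) *)
Definition is_Sp1U1 (h : M) : Prop :=
  exists (t : R) (alpha : quat R),
    qconj alpha * alpha = 1 /\ h = diag2 (expi t) alpha.

Lemma diag2_is_Sp2 t (alpha : quat R) :
  qconj alpha * alpha = 1 -> is_Sp2 (diag2 (expi t) alpha).
Proof.
move=> h; have h' := qunit_comm h.
rewrite /is_Sp2 /diag2 conjtr_mat2 !mul_mat2 mat2_1 h h' qconj_expi -!expiD.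
by rewrite subrr addNr expi0 qconj0 !(mulr0, mul0r, addr0, add0r) eqxx.
Qed.
Lemma Sp1U1_Sp2 h : is_Sp1U1 h -> is_Sp2 h.
Proof. by case=> t [al [al1 ->]]; exact: diag2_is_Sp2. Qed.
Lemma Sp1U1_1 : is_Sp1U1 1%:M.
Proof.
by exists 0, 1; rewrite expi0 mat2_1 qconj1 mulr1.
Qed.
Lemma Sp1U1_conjtr h : is_Sp1U1 h -> is_Sp1U1 (conjtr h).
Proof.
case=> t [al [al1 ->]]; exists (- t), (qconj al).
by rewrite qconjK (qunit_comm al1) conjtr_mat2 qconj_expi qconj0.
Qed.
Lemma Sp1U1_mul h k : is_Sp1U1 h -> is_Sp1U1 k -> is_Sp1U1 (h *m k).
Proof.
case=> t [al [al1 ->]] [s [be [be1 ->]]]; exists (t + s), (al * be); split.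
  by rewrite qconjM mulrA -(mulrA _ _ al) al1 mulr1 be1.
by rewrite mul_mat2 expiD !(mulr0, mul0r, addr0, add0r).
Qed.

Definition same_coset (p q : Sp2 R) : bool :=
  `[< exists2 h : M, is_Sp1U1 h & sp2mx q = sp2mx p *m h >].

Fact same_coset_refl : reflexive same_coset.
Proof.
by move=> p; apply/asboolP; exists 1%:M; rewrite ?mulmx1 //; exact: Sp1U1_1.
Qed.
Fact same_coset_imp p q : same_coset p q -> same_coset q p.
Proof.
move=> /asboolP[h hH qE]; apply/asboolP.
exists (conjtr h); first exact: Sp1U1_conjtr.
by rewrite qE -mulmxA (sp2_mulV (MkSp2 (Sp1U1_Sp2 hH))) mulmx1.
Qed.
Fact same_coset_sym : symmetric same_coset.
Proof. by move=> p q; apply/idP/idP; exact: same_coset_imp. Qed.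
Fact same_coset_trans : transitive same_coset.
Proof.
move=> q p r /asboolP[h hH qE] /asboolP[k kH rE]; apply/asboolP.
by exists (h *m k); [exact: Sp1U1_mul | rewrite rE qE mulmxA].
Qed.

Canonical same_coset_equiv :=
  EquivRel same_coset same_coset_refl same_coset_sym same_coset_trans.

(* CP^3 as the space of left cosets p Sp(1)U(1) *)
Definition CP3 := {eq_quot same_coset}.
HB.instance Definition _ := EqQuotient.on CP3.
HB.instance Definition _ := Choice.on CP3.

Definition CP3_act (g : Sp2 R) (x : CP3) : CP3 := \pi_CP3 (sp2_mul g (repr x)).

Lemma CP3_act_pi g p : CP3_act g (\pi_CP3 p) = \pi_CP3 (sp2_mul g p).
Proof.
apply/eqquotP; case: piP => q /eqquotP/asboolP[h hH qE].
apply: same_coset_imp; apply/asboolP; exists h => //=.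
by rewrite qE mulmxA.
Qed.

Lemma expi_unit s : qconj (expi s) * expi s = 1.
Proof. by rewrite qconj_expi -expiD addNr expi0. Qed.
Definition torus (t s : R) : Sp2 R :=
  MkSp2 (@diag2_is_Sp2 t (expi s) (expi_unit s)).

Definition T2orbit (x : CP3) : set CP3 :=
  [set CP3_act (torus u.1 u.2) x | u in [set: R * R]].

Definition is_sp2 (X : M) : Prop := conjtr X = - X.
Definition is_h (X : M) : Prop :=
  exists (r : R) (beta : quat R),
    qconj beta = - beta /\ X = diag2 (Quat (0 +i* r)%C 0) beta.
Definition is_m (X : M) : Prop :=
  exists (x : R[i]) (rho : quat R), X = mat2 (Quat 0 x) rho (- qconj rho) 0.

Definition projm (X : M) : M := mat2 (Quat 0 (qsnd (X 0 0))) (X 0 1) (X 1 0) 0.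

Definition g0 (X Y : M) : R := qre (\tr (conjtr X *m Y)).

Definition Arot : M := diag2 (expi (2 * pi / 3)) 1.

(* Arot lies in Sp(2), so its inverse is its conjugate transpose. *)
Definition J0 (X : M) : M :=
  qreal (2 / Num.sqrt 3) *: (Arot *m X *m conjtr Arot + qreal 2^-1 *: X).

Definition sigma0 (X Y : M) : R := g0 (J0 X) Y.

Definition Umx : M := diag2 (Quat 'i%C 0) 0.
Definition Vmx : M := diag2 0 (Quat 'i%C 0).

(* projm is the projection along h in sp(2) = h (+) m. *)
Lemma projmP (X : M) : is_sp2 X -> is_m (projm X) /\ is_h (X - projm X).
Proof.
rewrite /is_sp2 /is_m /is_h /projm => /matrixP XN.
have X00 := XN 0 0; have X10 := XN 0 1; have X11 := XN 1 1.
rewrite !mxE in X00 X10 X11; split.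
  exists (qsnd (X 0 0)), (X 0 1); congr mat2.
  by rewrite -[RHS]qconjN -X10 qconjK.
have a0 : qfst (X 0 0) = (0 +i* complex.Im (qfst (X 0 0)))%C.
  move/(congr1 (fun q => complex.Re (qfst q))): X00.
  case: (X 0 0) => [[a b] w] /= aN; congr (_ +i* _)%C.
  by apply/eqP; rewrite -eqNr -aN.
exists (complex.Im (qfst (X 0 0))), (X 1 1); split; first exact: X11.
rewrite -a0; apply/matrixP; apply: ord2P; apply: ord2P; rewrite !mxE /=.
- by rewrite qoppE qaddE /= subrr oppr0 addr0.
- exact: subrr.
- exact: subrr.
- by rewrite subr0.
Qed.

Lemma h_m_trivial (X : M) : is_h X -> is_m X -> X = 0.
Proof.
case=> r [b [_ XE]] [x [rho XE']]; rewrite XE in XE' *.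
move/matrixP: XE' => E.
have E00 := E 0 0; have E01 := E 0 1; have E11 := E 1 1.
rewrite !mxE in E00 E01 E11; case: E00 => -> _.
by rewrite /= in E11; rewrite E11; apply/matrixP; apply: ord2P; apply: ord2P; rewrite !mxE.
Qed.

Definition nu_Sp2 (p : Sp2 R) : R :=
  sigma0 (projm (conjtr p *m Umx *m p)) (projm (conjtr p *m Vmx *m p)).

(* By nu_pi below, the choice of the representative of x is irrelevant. *)
Definition nu (x : CP3) : R := nu_Sp2 (repr x).

Lemma projm_conj h X : is_Sp1U1 h ->
  projm (conjtr h *m X *m h) = conjtr h *m projm X *m h.
Proof.
case=> t [al [_ ->]]; rewrite (mat2_eta X) /projm /diag2.
rewrite !(conjtr_mat2, mul_mat2, qconj0, mul0r, mulr0, addr0, add0r).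
rewrite !mxE /=; congr mat2; case: (X 0 0) => [[a b] [c d]].
rewrite !qmulE /=.
by congr (Quat (_ +i* _)%C (_ +i* _)%C); ring.
Qed.

Lemma J0_conj h X : is_Sp1U1 h ->
  J0 (conjtr h *m X *m h) = conjtr h *m J0 X *m h.
Proof.
move=> hH; have comA k : is_Sp1U1 k -> Arot *m k = k *m Arot.
  case=> t [al [_ ->]]; rewrite /Arot !mul_mat2 expiC.
  by rewrite !(mul0r, mulr0, addr0, add0r, mul1r, mulr1).
have hH' := Sp1U1_conjtr hH.
rewrite /J0 mulmx_qreal -scalemxAl mulmxDr mulmxDl mulmx_qreal -scalemxAl.
congr (_ *: (_ + _)).
have comA' : h *m conjtr Arot = conjtr Arot *m h.
  by rewrite -[LHS]conjtrK conjtrM conjtrK comA // conjtrM conjtrK.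
by rewrite !mulmxA comA // -(mulmxA _ h) comA' !mulmxA.
Qed.

Lemma g0_conj h X Y : is_Sp1U1 h ->
  g0 (conjtr h *m X *m h) (conjtr h *m Y *m h) = g0 X Y.
Proof.
move=> hH; have hh := sp2_mulV (MkSp2 (Sp1U1_Sp2 hH)); rewrite /= in hh.
rewrite /g0 !conjtrM conjtrK -!mulmxA (mulmxA h) hh mul1mx qre_mxtraceC.
by rewrite -!mulmxA hh mulmx1.
Qed.

Lemma nu_pi p : nu (\pi_CP3 p) = nu_Sp2 p.
Proof.
rewrite /nu; case: piP => q /eqquotP/asboolP[h hH qE].
rewrite /nu_Sp2 qE.
have conjE Z : conjtr (sp2mx p *m h) *m Z *m (sp2mx p *m h) =
    conjtr h *m (conjtr p *m Z *m p) *m h by rewrite conjtrM !mulmxA.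
by rewrite !conjE !(projm_conj _ hH) /sigma0 J0_conj // g0_conj.
Qed.

Definition derivable_curve (c : R -> Sp2 R) : Prop :=
  forall (t : R) (i j : 'I_2),
    [/\ derivable (fun s => complex.Re (qfst (c s i j))) t 1,
        derivable (fun s => complex.Im (qfst (c s i j))) t 1,
        derivable (fun s => complex.Re (qsnd (c s i j))) t 1 &
        derivable (fun s => complex.Im (qsnd (c s i j))) t 1].

(* d nu vanishes at x. The projection Sp(2) -> CP^3 is a submersion, so every
   tangent vector at x is the velocity at 0 of the projection of a curve in
   Sp(2) lying above x at time 0. *)
Definition critical (x : CP3) : Prop :=
  forall c : R -> Sp2 R, derivable_curve c -> \pi_CP3 (c 0) = x ->
    is_derive (0 : R) (1 : R) (fun t : R => nu (\pi_CP3 (c t))) 0.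

End ProjectiveSpace.

(* Main.v *)
Require Import Defs.
From mathcomp Require Import all_boot all_order all_algebra.
From mathcomp Require Import generic_quotient.
From mathcomp Require Import all_classical all_reals all_analysis.
From mathcomp Require Import complex ring lra.
Import Order.TTheory GRing.Theory Num.Theory.
Import numFieldNormedType.Exports.
Local Open Scope ring_scope.
Local Open Scope quotient_scope.
Local Open Scope classical_set_scope.

(* If (a, c) is the first column of p, with a = a1 + a2 j and c = c1 + c2 j,
   then nu = 12 Im m with m = conj(a1) a2 c1 conj(c2), and
   |a1|^2 + |a2|^2 + |c1|^2 + |c2|^2 = 1, so |nu| <= 3/4 by AM-GM, with equality
   iff all four moduli are 1/2 and m is purely imaginary. The torus and the
   right action of U(1) move the phases of a1, a2, c1, c2 freely subject to
   keeping m fixed, so nu = 3/4 and nu = -3/4 are each a single orbit, critical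
   because nu is extremal there. Conversely, at a critical point with nu <> 0,
   differentiating along exp(tX) p for X = diag(j, 0), diag(k, 0), diag(0, j),
   diag(0, k) forces |a1| = |a2|, |c1| = |c2| and Re m = 0; the two off-diagonal
   X with entries 1, -1 and i, i then force |a1| = |c1|. *)

Section MultiMoment.
Set Implicit Arguments.
Unset Strict Implicit.
Unset Printing Implicit Defensive.
Variable R : realType.
Implicit Types (a c : quat R) (t : R).

(** * The multi-moment map in terms of the first column *)

Lemma quat_eq (x1 x2 x3 x4 y1 y2 y3 y4 : R) :
  x1 = y1 -> x2 = y2 -> x3 = y3 -> x4 = y4 ->
  Quat (x1 +i* x2)%C (x3 +i* x4)%C = Quat (y1 +i* y2)%C (y3 +i* y4)%C.
Proof. by move=> -> -> -> ->. Qed.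

Lemma cos_sin_2pi3 :
  cos (2 * pi / 3 : R) = - 2^-1 /\ sin (2 * pi / 3 : R) = Num.sqrt 3 / 2.
Proof.
pose t : R := pi / 3; have pi0 := pi_gt0 R.
have tE : 2 * pi / 3 = t *+ 2 by rewrite /t -mulr_natl; ring.
have t3 : pi = t *+ 2 + t :> R by rewrite /t -mulr_natl; field.
have st0 : 0 < sin t by apply: sin_gt0_pi; rewrite /t; lra.
have s2t0 : 0 < sin (t *+ 2) by apply: sin_gt0_pi; rewrite -tE; lra.
(* This is sin(pi - t) = sin t for t = pi/3. With the double-angle formula and sin t > 0 it gives 2
   cos t = 1. *)
have e1 : sin (t *+ 2) = sin t.
  have := sinpi R; have := cospi R; rewrite t3 sinD cosD => h1 h2.
  have := cos2Dsin2 t => h3.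
  have : sin (t *+ 2) * (cos t ^+ 2 + sin t ^+ 2) = sin t.
    transitivity (cos t * (sin (t *+ 2) * cos t + cos (t *+ 2) * sin t)
      - sin t * (cos (t *+ 2) * cos t - sin (t *+ 2) * sin t)); first by ring.
    by rewrite h1 h2; ring.
  by rewrite h3 mulr1.
have ct : cos t = 2^-1.
  move: e1; rewrite sin_mulr2n -mulr_natl => e1.
  have : sin t * (2 * cos t - 1) = 0 by rewrite mulrBr mulr1 -[X in _ - X]e1; ring.
  by move=> /eqP; rewrite mulf_eq0 gt_eqF //= subr_eq0 => /eqP h; lra.
rewrite tE cos_mulr2n ct -mulr_natl; split; first by field.
have s0 : (0 : R) <= Num.sqrt 3 / 2 by rewrite divr_ge0 ?sqrtr_ge0.
apply/eqP; rewrite -(@eqrXn2 _ 2) ?ltW // e1; apply/eqP.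
have := cos2Dsin2 t; rewrite ct => h.
rewrite expr_div_n sqr_sqrtr ?ler0n //; lra.
Qed.

(** Conjugation by [Arot] multiplies the [x] entry by e^(4 pi i/3), [rho] on the left by e^(2 pi
    i/3) and [sigma] on the right by e^(-2 pi i/3). Adding 1/2 leaves the imaginary parts, which are
    sqrt 3/2 up to sign, and the prefactor of [J0] normalises them to a unit. *)
Lemma J0_m (x : R[i]) (rho sigma : quat R) :
  J0 (mat2 (Quat 0 x) rho sigma 0) =
  mat2 (Quat 0 (- 'i%C * x)) (Quat 'i%C 0 * rho) (- (sigma * Quat 'i%C 0)) 0.
Proof.
have [c23 s23] := cos_sin_2pi3.
have s3 : Num.sqrt 3 != 0 :> R by rewrite sqrtr_eq0 -ltNge ltr0n.
rewrite /J0 /Arot /diag2 !(conjtr_mat2, mul_mat2, qconj0, qconj1).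
rewrite !(mul0r, mulr0, addr0, add0r, mul1r, mulr1) /expi c23 s23 /qreal.
case: x rho sigma => [x1 x2] [[r1 r2] [r3 r4]] [[u1 u2] [u3 u4]].
have sq3 : (Num.sqrt 3 : R) ^+ 2 = 3 by rewrite sqr_sqrtr ?ler0n.
apply/matrixP; apply: ord2P; apply: ord2P; rewrite !mxE /= !(qmulE,qaddE,qoppE) /=;
  simpc; apply: quat_eq; field: sq3; (by [] || exact: s3).
Qed.

(** Up to the factor 12, the complex monomial with imaginary part nu. Left torus phases cancel
    inside conj(a1) a2 and inside c1 conj(c2); a right phase e^(it) contributes e^(-2it) to the
    first pair and e^(2it) to the second. *)
Definition phase a c : R[i] :=
  conjc (qfst a) * qsnd a * (qfst c * conjc (qsnd c)).

Definition nuq a c : R := 12 * complex.Im (phase a c).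

(** Orthogonality of the two rows, a conj(c) + b conj(d) = 0, removes the second column: after
    cyclic permutation under [qre], [b] and [d] occur only through d conj(b) or b conj(d). *)
Lemma nu_Sp2E (p : Sp2 R) : nu_Sp2 p = nuq (p 0 0) (p 1 0).
Proof.
have := sp2_mulV p; rewrite (mat2_eta p) conjtr_mat2 mul_mat2 mat2_1.
move=> /matrixP/(_ 0 1); rewrite !mxE /=.
rewrite /nu_Sp2 /sigma0.
set a := p 0 0; set b := p 0 1; set c := p 1 0; set d := p 1 1 => orth.
rewrite (mat2_eta p) -/a -/b -/c -/d.
have bd : b * qconj d = - (a * qconj c).
  by apply/eqP; rewrite -addr_eq0 addrC orth.
have db : d * qconj b = - (c * qconj a).
  by rewrite -[d * _]qconjK qconjM qconjK bd qconjN qconjM qconjK.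
pose I : quat R := Quat 'i%C 0.
have IN : qconj I = - I.
  by rewrite /qconj /I qoppE /=; apply: quat_eq; rewrite /= ?oppr0.
rewrite /Umx /Vmx /diag2 -/I !(conjtr_mat2, mul_mat2, qconj0).
rewrite !(mul0r, mulr0, addr0, add0r) /projm !mxE /= J0_m -/I.
rewrite /g0 conjtr_mat2 !mul_mat2 /mxtrace !big_ord_recl big_ord0 !mxE /=.
rewrite !qconj0 !(mul0r, mulr0, addr0, add0r) !qreD.
rewrite qconjN !qconjM !qconjK IN.
have -> : qre (qconj b * (- I * a) * - I * (qconj c * I * d)) =
    - qre (I * a * I * qconj c * I * c * qconj a).
  transitivity (qre (qconj b * (I * a * I * qconj c * I * d))).
    by congr qre; rewrite !(mulNr, mulrN) opprK !mulrA.
  rewrite qreC -!mulrA db; case: (a) (c) => [[? ?] [? ?]] [[? ?] [? ?]].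
  by rewrite /qre !(mulrN, qoppE) /=.
have -> : - (- I * (qconj a * (- I * b))) * (qconj d * I * c) =
    I * qconj a * I * a * qconj c * I * c.
  rewrite !(mulNr, mulrN) opprK -!mulrA (mulrA b) bd.
  by rewrite !(mulNr, mulrN) opprK -!mulrA.
rewrite /nuq /phase /I; move: (a) (c) => [[a1 a2] [a3 a4]] [[c1 c2] [c3 c4]].
rewrite /qre !qmulE /=; ring.
Qed.

(** * The sharp bound on nu and its equality case *)

Definition sqn (z : R[i]) : R := complex.Re z ^+ 2 + complex.Im z ^+ 2.

Lemma sqn_ge0 z : 0 <= sqn z.
Proof. by rewrite addr_ge0 ?sqr_ge0. Qed.

Lemma sqnM z w : sqn (z * w) = sqn z * sqn w.
Proof. by case: z w => [z1 z2] [w1 w2]; rewrite /sqn /=; ring. Qed.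

Lemma sqn_conjc z : sqn (conjc z) = sqn z.
Proof. by case: z => [z1 z2]; rewrite /sqn /= sqrrN. Qed.

(** Two-variable AM-GM is applied three times: to x1, x2, to x3, x4, and to the pair sums [u], [v]
    with u + v = 1. Each product is written as its maximum minus a square, so equality makes every
    square vanish. *)
Lemma amgm4 (x1 x2 x3 x4 : R) :
  0 <= x1 -> 0 <= x2 -> 0 <= x3 -> 0 <= x4 -> x1 + x2 + x3 + x4 = 1 ->
  x1 * x2 * (x3 * x4) <= 256^-1 /\
  (256^-1 <= x1 * x2 * (x3 * x4) ->
    [/\ x1 = 4^-1, x2 = 4^-1, x3 = 4^-1 & x4 = 4^-1]).
Proof.
move=> x10 x20 x30 x40 s1.
pose u := x1 + x2; pose v := x3 + x4.
have u0 : 0 <= u by rewrite addr_ge0.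
have v0 : 0 <= v by rewrite addr_ge0.
have uv : u * v = 4^-1 - (u - v) ^+ 2 / 4.
  have -> : v = 1 - u by rewrite /u /v; lra.
  by field.
have x12 : x1 * x2 = u ^+ 2 / 4 - (x1 - x2) ^+ 2 / 4 by rewrite /u; field.
have x34 : x3 * x4 = v ^+ 2 / 4 - (x3 - x4) ^+ 2 / 4 by rewrite /v; field.
have x12le : x1 * x2 <= u ^+ 2 / 4 by have := sqr_ge0 (x1 - x2); lra.
have x34le : x3 * x4 <= v ^+ 2 / 4 by have := sqr_ge0 (x3 - x4); lra.
have uvle : u * v <= 4^-1 by have := sqr_ge0 (u - v); lra.
have uv0 : 0 <= u * v by rewrite mulr_ge0.
have le1 : x1 * x2 * (x3 * x4) <= (u * v) ^+ 2 / 16.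
  have -> : (u * v) ^+ 2 / 16 = (u ^+ 2 / 4) * (v ^+ 2 / 4) by field.
  by rewrite ler_pM // mulr_ge0.
have le2 : (u * v) ^+ 2 <= 4^-1 ^+ 2 by rewrite lerXn2r // nnegrE; lra.
split => [|ge]; first by move: le2; lra.
have uvE : u * v = 4^-1.
  have : 16^-1 <= (u * v) ^+ 2 by lra.
  by move: (u * v) uv0 uvle => y y0 yle yge; nra.
have uv2 : u = v.
  have : (u - v) ^+ 2 = 0 by lra.
  by move=> /eqP; rewrite sqrf_eq0 subr_eq0 => /eqP.
have uE : u = 2^-1 by move: uv2 s1; rewrite /u /v; lra.
have vE : v = 2^-1 by rewrite -uv2.
have uu : u ^+ 2 / 4 = 16^-1 by rewrite uE; field.
have vv : v ^+ 2 / 4 = 16^-1 by rewrite vE; field.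
rewrite uu in x12le x12; rewrite vv in x34le x34.
have x12'0 : 0 <= x1 * x2 by rewrite mulr_ge0.
have x34'0 : 0 <= x3 * x4 by rewrite mulr_ge0.
have e12 : x1 * x2 = 16^-1 by nra.
have e34 : x3 * x4 = 16^-1 by nra.
have : (x1 - x2) ^+ 2 = 0 by lra.
have : (x3 - x4) ^+ 2 = 0 by lra.
move=> /eqP; rewrite sqrf_eq0 => /eqP h3 /eqP; rewrite sqrf_eq0 => /eqP h1.
by move: uE vE; rewrite /u /v => uE vE; split; lra.
Qed.

Definition colnorm a c : R :=
  sqn (qfst a) + sqn (qsnd a) + sqn (qfst c) + sqn (qsnd c).

Lemma colnorm_sp2 (p : Sp2 R) : colnorm (p 0 0) (p 1 0) = 1.
Proof.
have := sp2_mulVl p; rewrite (mat2_eta p) conjtr_mat2 mul_mat2 mat2_1.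
move=> /matrixP/(_ 0 0); rewrite !mxE /=.
case: (p 0 0) (p 1 0) => [[a1 a2] [a3 a4]] [[c1 c2] [c3 c4]].
move=> /(congr1 (@qre R)); rewrite /qre /colnorm /sqn /= => <-; ring.
Qed.

Lemma sqn_phase a c :
  sqn (phase a c) = sqn (qfst a) * sqn (qsnd a) * (sqn (qfst c) * sqn (qsnd c)).
Proof. by rewrite /phase !(sqnM, sqn_conjc). Qed.

Definition extremal a c : Prop :=
  [/\ sqn (qfst a) = 4^-1, sqn (qsnd a) = 4^-1, sqn (qfst c) = 4^-1
    & sqn (qsnd c) = 4^-1] /\ complex.Re (phase a c) = 0.

(** The squared modulus of m is the product of four nonnegative numbers with sum 1, hence at most
    (1/4)^4 = 1/256; the squared imaginary part falls short of it by the squared real part. *)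
Lemma phase_bound a c : colnorm a c = 1 ->
  complex.Im (phase a c) ^+ 2 <= 256^-1 /\
  (complex.Im (phase a c) ^+ 2 = 256^-1 <-> extremal a c).
Proof.
move=> n1.
have [le eqc] := amgm4 (sqn_ge0 _) (sqn_ge0 _) (sqn_ge0 _) (sqn_ge0 _) n1.
rewrite -sqn_phase [sqn (phase _ _)]/sqn in le eqc.
have r0 := sqr_ge0 (complex.Re (phase a c)).
split; first by lra.
split=> [h|[[h1 h2 h3 h4] h]].
  split; first by apply: eqc; rewrite h; lra.
  by apply/eqP; rewrite -sqrf_eq0; apply/eqP; lra.
have := sqn_phase a c; rewrite h1 h2 h3 h4 /sqn h expr0n /= add0r => ->.
by field.
Qed.

Lemma nuq_bound a c : colnorm a c = 1 -> - (3 / 4) <= nuq a c <= 3 / 4.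
Proof.
move=> /phase_bound[h _]; rewrite /nuq.
by move: (complex.Im _) h => y h; nra.
Qed.

Lemma nuq_extremal a c : colnorm a c = 1 ->
  (extremal a c <-> nuq a c = 3 / 4 \/ nuq a c = - (3 / 4)).
Proof.
move=> /phase_bound[_ h]; rewrite -h /nuq.
move: (complex.Im _) {h} => y; split=> [|[]] e; last 2 first.
- have -> : y = 16^-1 by lra.
  by field.
- have -> : y = - 16^-1 by lra.
  by field.
have : (y - 16^-1) * (y + 16^-1) = 0 by rewrite mulrBl !mulrDr; lra.
by move=> /eqP; rewrite mulf_eq0 => /orP[] /eqP h; [left|right]; lra.
Qed.

(** * The derivative of nu along a moving first column *)

Definition is_qderive (u : R -> quat R) t (u' : quat R) : Prop :=
  [/\ is_derive t (1 : R) (fun s => complex.Re (qfst (u s))) (complex.Re (qfst u')),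
      is_derive t (1 : R) (fun s => complex.Im (qfst (u s))) (complex.Im (qfst u')),
      is_derive t (1 : R) (fun s => complex.Re (qsnd (u s))) (complex.Re (qsnd u')) &
      is_derive t (1 : R) (fun s => complex.Im (qsnd (u s))) (complex.Im (qsnd u'))].

(** The product rule for [nuq], with [a'] and [c'] the velocities of [a] and [c]. *)
Definition dnuq a c a' c' : R :=
  12 * complex.Im
    ((conjc (qfst a') * qsnd a + conjc (qfst a) * qsnd a')
       * (qfst c * conjc (qsnd c)) +
     conjc (qfst a) * qsnd a
       * (qfst c' * conjc (qsnd c) + qfst c * conjc (qsnd c'))).

Lemma is_derive_nuq (u v : R -> quat R) t u' v' :
  is_qderive u t u' -> is_qderive v t v' ->
  is_derive t (1 : R) (fun s => nuq (u s) (v s)) (dnuq (u t) (v t) u' v').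
Proof.
case=> x1 x2 x3 x4 [y1 y2 y3 y4].
pose X1 s := complex.Re (qfst (u s)); pose X2 s := complex.Im (qfst (u s)).
pose X3 s := complex.Re (qsnd (u s)); pose X4 s := complex.Im (qsnd (u s)).
pose Y1 s := complex.Re (qfst (v s)); pose Y2 s := complex.Im (qfst (v s)).
pose Y3 s := complex.Re (qsnd (v s)); pose Y4 s := complex.Im (qsnd (v s)).
(* In real coordinates, Im(z w) = Re z Im w + Im z Re w with z = conj(a1) a2 and w = c1 conj(c2). *)
have -> : (fun s => nuq (u s) (v s)) =
  (cst 12 : R -> R) * ((X1 * X3 + X2 * X4) * (Y2 * Y3 - Y1 * Y4)
                       + (X1 * X4 - X2 * X3) * (Y1 * Y3 + Y2 * Y4)).
  apply/funext => s; rewrite /nuq /phase !fctE /X1 /X2 /X3 /X4 /Y1 /Y2 /Y3 /Y4.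
  by case: (u s) (v s) => [[? ?] [? ?]] [[? ?] [? ?]] /=; ring.
rewrite -/X1 in x1; rewrite -/X2 in x2; rewrite -/X3 in x3; rewrite -/X4 in x4.
rewrite -/Y1 in y1; rewrite -/Y2 in y2; rewrite -/Y3 in y3; rewrite -/Y4 in y4.
have dA := is_deriveD (is_deriveM x1 x3) (is_deriveM x2 x4).
have dB := is_deriveB (is_deriveM y2 y3) (is_deriveM y1 y4).
have dC := is_deriveB (is_deriveM x1 x4) (is_deriveM x2 x3).
have dD := is_deriveD (is_deriveM y1 y3) (is_deriveM y2 y4).
have dF := is_deriveM (is_derive_cst (12 : R) t 1)
  (is_deriveD (is_deriveM dA dB) (is_deriveM dC dD)).
apply: (is_derive_eq dF).
rewrite !fctE /X1 /X2 /X3 /X4 /Y1 /Y2 /Y3 /Y4 /dnuq.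
case: (u t) (v t) u' v' {x1 x2 x3 x4 y1 y2 y3 y4 dA dB dC dD dF} =>
  [[? ?] [? ?]] [[? ?] [? ?]] [[? ?] [? ?]] [[? ?] [? ?]] /=.
rewrite /GRing.scale /=; ring.
Qed.

(** * Rotation curves in Sp(2) as tests of criticality *)

Lemma is_derive_sin_cos (x y z t : R) :
  is_derive t (1 : R) (fun s => x + sin s * y + (1 - cos s) * z)
    (cos t * y + sin t * z).
Proof.
have -> : (fun s => x + sin s * y + (1 - cos s) * z) =
  cst x + (@sin R) * cst y + (cst 1 - @cos R) * cst z by [].
have dS := is_deriveM (is_derive_sin t) (is_derive_cst y t 1).
have dC := is_deriveM (is_deriveB (is_derive_cst (1 : R) t 1) (is_derive_cos t))
  (is_derive_cst z t 1).
apply: (is_derive_eq (is_deriveD (is_deriveD (is_derive_cst x t 1) dS) dC)).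
by rewrite !fctE /GRing.scale /=; ring.
Qed.

Lemma is_qderive_sin_cos (q0 q1 q2 : quat R) t :
  is_qderive (fun s => q0 + qreal (sin s) * q1 + qreal (1 - cos s) * q2) t
    (qreal (cos t) * q1 + qreal (sin t) * q2).
Proof.
case: q0 q1 q2 => [[a1 a2] [a3 a4]] [[b1 b2] [b3 b4]] [[c1 c2] [c3 c4]].
have E x y z (f : R -> R) e :
    (forall s, f s = x + sin s * y + (1 - cos s) * z) ->
    e = cos t * y + sin t * z -> is_derive t (1 : R) f e.
  by move=> /funext -> ->; exact: is_derive_sin_cos.
split; [apply: (E a1 b1 c1) => [s|] | apply: (E a2 b2 c2) => [s|]
  | apply: (E a3 b3 c3) => [s|] | apply: (E a4 b4 c4) => [s|]];
  rewrite /qreal !(qmulE, qaddE) /=; ring.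
Qed.

(* This is exp(tX) when X^3 = -X. *)
Definition rotation (X : 'M[quat R]_2) t : 'M[quat R]_2 :=
  1%:M + qreal (sin t) *: X + qreal (1 - cos t) *: (X *m X).

Lemma conjtrD (X Y : 'M[quat R]_2) : conjtr (X + Y) = conjtr X + conjtr Y.
Proof. by apply/matrixP => i j; rewrite !mxE qconjD. Qed.

Lemma conjtr_qreal r (X : 'M[quat R]_2) :
  conjtr (qreal r *: X) = qreal r *: conjtr X.
Proof.
have qr : qconj (qreal r) = qreal r.
  by rewrite /qconj /qreal /=; apply: quat_eq; rewrite ?oppr0.
by apply/matrixP => i j; rewrite !mxE qconjM qr qrealC.
Qed.

Lemma conjtr_rotation X t : is_sp2 X -> conjtr (rotation X t) = rotation X (- t).
Proof.
move=> XN; rewrite /rotation !(conjtrD, conjtr_qreal, conjtrM, conjtr1) XN.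
rewrite mulNmx mulmxN opprK sinN cosN; congr (_ + _ + _).
have -> : qreal (- sin t) = - qreal (sin t).
  by rewrite /qreal qoppE /=; apply: quat_eq; rewrite ?oppr0.
by rewrite scalerN scaleNr.
Qed.

Lemma qrealD (r s : R) : qreal (r + s) = qreal r + qreal s.
Proof. by rewrite /qreal qaddE; apply: quat_eq; rewrite /= ?addr0. Qed.

Lemma qrealM (r s : R) : qreal (r * s) = qreal r * qreal s.
Proof. by rewrite /qreal qmulE /=; apply: quat_eq => /=; ring. Qed.

(** Since X^3 = -X and X^4 = -X^2, the product reduces to a combination of 1, X and X^2. The X terms
    cancel, and the coefficient of X^2 vanishes by sin^2 + cos^2 = 1. *)
Lemma rotationV X t : X *m X *m X = - X -> rotation X t *m rotation X (- t) = 1%:M.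
Proof.
move=> X3; have X3' : X *m (X *m X) = - X by rewrite mulmxA.
have X4 : X *m X *m (X *m X) = - (X *m X) by rewrite mulmxA X3 mulNmx.
rewrite /rotation !(mulmxDl, mulmxDr, mulmx_qreal, mul1mx, mulmx1) -!scalemxAl.
rewrite X3 X3' X4 sinN cosN !scalerA -!qrealM.
have cs := sin2cos2 t; set S := sin t in cs *; set C := cos t in cs *.
apply/matrixP => i j; rewrite !mxE; set e : quat R := (i == j)%:R.
move: e (X i j) (\sum_k _) => [[? ?] [? ?]] [[? ?] [? ?]] [[? ?] [? ?]].
by rewrite /qreal !(qmulE, qaddE, qoppE) /=; apply: quat_eq; ring: cs.
Qed.

Lemma rotation_is_Sp2 X t :
  is_sp2 X -> X *m X *m X = - X -> is_Sp2 (rotation X t).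
Proof.
move=> XN X3; have := rotationV (- t) X3; rewrite opprK => V.
rewrite /is_Sp2 (conjtr_rotation t XN).
by apply/andP; split; apply/eqP; [exact: rotationV | exact: V].
Qed.

Definition rotation_Sp2 X (XN : is_sp2 X) (X3 : X *m X *m X = - X) t : Sp2 R :=
  MkSp2 (rotation_is_Sp2 t XN X3).

Lemma is_qderive_rotation X (p : 'M[quat R]_2) t i j :
  is_qderive (fun s => (rotation X s *m p) i j) t
    (qreal (cos t) * (X *m p) i j + qreal (sin t) * (X *m X *m p) i j).
Proof.
have -> : (fun s => (rotation X s *m p) i j) = (fun s => p i j
    + qreal (sin s) * (X *m p) i j + qreal (1 - cos s) * (X *m X *m p) i j).
  apply/funext => s; rewrite /rotation !mulmxDl mul1mx -!scalemxAl.
  rewrite mxE [X in X + _]mxE; congr (_ + _ + _); exact: mxE.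
exact: is_qderive_sin_cos.
Qed.

(** Criticality is tested on the curve exp(tX) p, which has velocity X p at 0; the derivative
    computed by the product rule must then be 0. *)
Lemma critical_dnuq (p : Sp2 R) X : is_sp2 X -> X *m X *m X = - X ->
  critical (\pi_(CP3 R) p) ->
  dnuq (p 0 0) (p 1 0) ((X *m p) 0 0) ((X *m p) 1 0) = 0.
Proof.
move=> XN X3 crit.
pose c t := sp2_mul (rotation_Sp2 XN X3 t) p.
have r0 : rotation X 0 = 1%:M.
  rewrite /rotation sin0 cos0 subrr.
  have -> : qreal 0 = 0 :> quat R by [].
  by rewrite !scale0r !addr0.
have c0 : c 0 = p by apply: val_inj; rewrite /= r0 mul1mx.
have dc : derivable_curve c.
  by move=> t i j; case: (is_qderive_rotation X p t i j) => ? ? ? ?; split.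
have := crit c dc; rewrite c0 => /(_ erefl).
have -> : (fun t => nu (\pi_(CP3 R) (c t))) =
    (fun t => nuq ((rotation X t *m p) 0 0) ((rotation X t *m p) 1 0)).
  by apply/funext => t; rewrite nu_pi nu_Sp2E.
move=> d0; have d1 := is_derive_nuq (is_qderive_rotation X p 0 0 0)
  (is_qderive_rotation X p 0 1 0).
have := @derive_val _ _ _ _ _ _ _ d0; rewrite (@derive_val _ _ _ _ _ _ _ d1).
rewrite r0 mul1mx sin0 cos0.
have -> : qreal 0 = 0 :> quat R by [].
have -> : qreal 1 = 1 :> quat R by [].
by rewrite !mul1r !mul0r !addr0.
Qed.

(** * Critical points with nonzero value are extremal *)

Lemma is_sp2_diag (q r : quat R) : qconj q = - q -> qconj r = - r -> is_sp2 (diag2 q r).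
Proof.
rewrite /is_sp2 conjtr_mat2 => -> ->; rewrite qconj0.
by apply/matrixP; apply: ord2P; apply: ord2P; rewrite !mxE /= ?oppr0.
Qed.

Lemma diag2_cube (q r : quat R) : q * q * q = - q -> r * r * r = - r ->
  diag2 q r *m diag2 q r *m diag2 q r = - diag2 q r :> 'M[quat R]_2.
Proof.
rewrite !mul_mat2 !(mul0r, mulr0, addr0, add0r) => -> ->.
by apply/matrixP; apply: ord2P; apply: ord2P; rewrite !mxE /= ?oppr0.
Qed.

Definition offdiag (q : quat R) := mat2 0 q (- qconj q) 0.

Lemma is_sp2_offdiag q : is_sp2 (offdiag q).
Proof.
rewrite /is_sp2 conjtr_mat2 qconj0 qconjN qconjK.
by apply/matrixP; apply: ord2P; apply: ord2P; rewrite !mxE /= ?oppr0 ?opprK.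
Qed.

(** For a unit quaternion [q] the square of [offdiag q] is minus the identity. *)
Lemma offdiag_cube q : qconj q * q = 1 ->
  offdiag q *m offdiag q *m offdiag q = - offdiag q.
Proof.
move=> q1; have q1' := qunit_comm q1.
rewrite !mul_mat2 !(mul0r, mulr0, addr0, add0r) mulNr mulrN q1 q1' !mulN1r.
by apply/matrixP; apply: ord2P; apply: ord2P; rewrite !mxE /= ?oppr0 ?opprK.
Qed.

Lemma sqnN (z : R[i]) : sqn (- z) = sqn z.
Proof. by case: z => [z1 z2]; rewrite /sqn /= !sqrrN. Qed.

(* The hypotheses say that v^2 w is minus the conjugate of u^2 w. *)
Lemma sqn_eq_of_critical (u v w : R[i]) :
  complex.Im ((u ^+ 2 - v ^+ 2) * w) = 0 ->
  complex.Re ((u ^+ 2 + v ^+ 2) * w) = 0 -> complex.Im (u * v * w) != 0 ->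
  sqn u = sqn v /\ complex.Re (u * v * w) = 0.
Proof.
move=> h1 h2 n0.
have vw : v ^+ 2 * w = - conjc (u ^+ 2 * w).
  move: h1 h2; rewrite mulrBl mulrDl.
  case: (u ^+ 2 * w) (v ^+ 2 * w) => [x1 x2] [y1 y2] /= h1 h2.
  by congr (_ +i* _)%C; lra.
have w0 : 0 < sqn w.
  rewrite lt_def sqn_ge0 andbT; apply: contra n0 => /eqP.
  case: w {h1 h2 vw} => w1 w2; rewrite /sqn /= => /eqP.
  by rewrite paddr_eq0 ?sqr_ge0 // !sqrf_eq0 => /andP[/eqP-> /eqP->];
     case: (u * v) => ? ? /=; rewrite !mulr0 addr0.
split.
  have : sqn (v ^+ 2 * w) = sqn (u ^+ 2 * w).
    by rewrite vw sqnN sqn_conjc.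
  rewrite !sqnM => /(mulIf (lt0r_neq0 w0)); rewrite -!expr2.
  by move=> /(pexpIrn (ltn0Sn 1)) h; rewrite h // nnegrE sqn_ge0.
(* The square of u v w is (u^2 w)(v^2 w), a nonpositive real; a number with such a square and
   nonzero imaginary part is purely imaginary. *)
have : (u * v * w) ^+ 2 = - (sqn (u ^+ 2 * w))%:C%C.
  transitivity (u ^+ 2 * w * (v ^+ 2 * w)); first by ring.
  rewrite vw; case: (u ^+ 2 * w) => x1 x2; rewrite /sqn; simpc.
  by congr (_ +i* _)%C; ring.
case: (u * v * w) n0 => x1 x2 /= x20; rewrite expr2; simpc.
case=> _ /eqP; rewrite mulrC -mulr2n mulrn_eq0 /= mulf_eq0 (negbTE x20) /=.
by move=> /eqP.
Qed.

(** If [r] were nonzero, [y] would be the conjugate of [x], and x y would be real. *)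
Lemma sqn_eq_of_critical_mixed (x y : R[i]) (r : R) :
  r * (complex.Im x + complex.Im y) = 0 ->
  r * (complex.Re x - complex.Re y) = 0 ->
  complex.Im (x * y) != 0 -> r = 0.
Proof.
case: x y => [x1 x2] [y1 y2] /= /eqP; rewrite mulf_eq0 => /orP[/eqP//|/eqP h1].
move/eqP; rewrite mulf_eq0 => /orP[/eqP//|/eqP h2] /eqP[].
have -> : y1 = x1 by lra.
have -> : y2 = - x2 by lra.
ring.
Qed.

Lemma mulmx2E (X Y : 'M[quat R]_2) i k :
  (X *m Y) i k = X i 0 * Y 0 k + X i 1 * Y 1 k.
Proof.
rewrite mxE !big_ord_recl big_ord0 addr0.
by congr (_ + X i _ * Y _ k); apply: val_inj.
Qed.

Lemma critical_extremal (p : Sp2 R) :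
  critical (\pi_(CP3 R) p) -> nuq (p 0 0) (p 1 0) != 0 ->
  extremal (p 0 0) (p 1 0).
Proof.
move=> crit n0.
have D (X : 'M[quat R]_2) : is_sp2 X -> X *m X *m X = - X -> dnuq (p 0 0) (p 1 0)
    (X 0 0 * p 0 0 + X 0 1 * p 1 0) (X 1 0 * p 0 0 + X 1 1 * p 1 0) = 0.
  by move=> h1 h2; have := critical_dnuq h1 h2 crit; rewrite !mulmx2E.
have n1 := colnorm_sp2 p.
move: (p 0 0) (p 1 0) n0 D n1 {crit} => a c n0 D n1.
pose j : quat R := Quat 0 1; pose k : quat R := Quat 0 'i%C.
have jN : qconj j = - j.
  by rewrite /qconj /j qoppE /=; apply: quat_eq; rewrite /= ?oppr0.
have kN : qconj k = - k.
  by rewrite /qconj /k qoppE /=; apply: quat_eq; rewrite /= ?oppr0.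
have z0 : qconj 0 = - 0 :> quat R by rewrite qconj0 oppr0.
have j3 : j * j * j = - j.
  by rewrite /j !qmulE qoppE /=; apply: quat_eq => /=; ring.
have k3 : k * k * k = - k.
  by rewrite /k !qmulE qoppE /=; apply: quat_eq => /=; ring.
have z3 : 0 * 0 * 0 = - 0 :> quat R by rewrite !mul0r oppr0.
have i1 : qconj (Quat 'i%C 0) * Quat 'i%C 0 = 1 :> quat R.
  by rewrite /qconj qmulE q1E; apply: quat_eq => /=; ring.
have o1 : qconj 1 * 1 = 1 :> quat R by rewrite qconj1 mulr1.
have := D _ (is_sp2_diag jN z0) (diag2_cube j3 z3).
have := D _ (is_sp2_diag kN z0) (diag2_cube k3 z3).
have := D _ (is_sp2_diag z0 jN) (diag2_cube z3 j3).
have := D _ (is_sp2_diag z0 kN) (diag2_cube z3 k3).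
have := D _ (is_sp2_offdiag 1) (offdiag_cube o1).
have := D _ (is_sp2_offdiag (Quat 'i%C 0)) (offdiag_cube i1).
rewrite !mxE /= !(mul0r, addr0, add0r, mul1r) => Di D1 Dck Dcj Dak Daj.
have ph0 : complex.Im (phase a c) != 0.
  by apply: contra n0 => /eqP h; rewrite /nuq h mulr0.
have [a12 re0] : sqn (conjc (qfst a)) = sqn (qsnd a) /\
    complex.Re (phase a c) = 0.
  (* Here u = conj(a1), v = a2, w = c1 conj(c2): left multiplication of [a] by j changes conj(a1) a2
     at the rate u^2 - v^2, and by k at the rate i(u^2 + v^2). *)
  apply: sqn_eq_of_critical ph0.
    move: Daj; rewrite /dnuq /j qmulE /=.
    case: a c {D Di D1 Dck Dcj Dak n0 n1} => [[? ?] [? ?]] [[? ?] [? ?]] /=.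
    lra.
  move: Dak; rewrite /dnuq /k qmulE /=.
  case: a c {D Di D1 Dck Dcj Daj n0 n1} => [[? ?] [? ?]] [[? ?] [? ?]] /=.
  lra.
have phC : phase a c = qfst c * conjc (qsnd c) * (conjc (qfst a) * qsnd a).
  by rewrite /phase mulrC.
have [c12 _] : sqn (qfst c) = sqn (conjc (qsnd c)) /\
    complex.Re (qfst c * conjc (qsnd c) * (conjc (qfst a) * qsnd a)) = 0.
  (* The same argument for the second row, with u = c1, v = conj(c2), w = conj(a1) a2. *)
  rewrite phC in ph0; apply: sqn_eq_of_critical ph0.
    move: Dcj; rewrite /dnuq /j qmulE /=.
    case: a c {D Di D1 Dck Daj Dak n0 n1 phC re0 a12} =>
      [[? ?] [? ?]] [[? ?] [? ?]] /=.
    lra.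
  move: Dck; rewrite /dnuq /k qmulE /=.
  case: a c {D Di D1 Dcj Daj Dak n0 n1 phC re0 a12} =>
    [[? ?] [? ?]] [[? ?] [? ?]] /=.
  lra.
rewrite !sqn_conjc in a12 c12.
have ac : sqn (qfst c) - sqn (qfst a) = 0.
  (* The off-diagonal directions give relations with coefficients |c1|^2 - |a1|^2 and |c2|^2 -
     |a2|^2. These agree by [a12] and [c12], so they factor out as [r], while the product of the two
     complex arguments is [phase a c]. *)
  apply: (@sqn_eq_of_critical_mixed (conjc (qfst a) * qfst c)
    (qsnd a * conjc (qsnd c))); last first.
  - by move: ph0; rewrite /phase mulrACA.
  - have E : 12 * ((sqn (qsnd c) - sqn (qsnd a)) * complex.Re (conjc (qfst a) * qfst c)
        - (sqn (qfst c) - sqn (qfst a)) * complex.Re (qsnd a * conjc (qsnd c))) = 0.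
      rewrite -Di /dnuq !qmulE /= /sqn.
      by case: (a) (c) => [[? ?] [? ?]] [[? ?] [? ?]] /=; ring.
    by move: E; rewrite -a12 -c12; lra.
  - have E : 12 * ((sqn (qfst c) - sqn (qfst a)) * complex.Im (qsnd a * conjc (qsnd c))
        + (sqn (qsnd c) - sqn (qsnd a)) * complex.Im (conjc (qfst a) * qfst c)) = 0.
      rewrite -D1 /dnuq qmulE /= /sqn.
      by case: (a) (c) => [[? ?] [? ?]] [[? ?] [? ?]] /=; ring.
    by move: E; rewrite -a12 -c12; lra.
move: n1; rewrite /colnorm => n1; split; last exact: re0.
by split; lra.
Qed.

(** * Phases, cosets and torus orbits *)

Definition cis t : R[i] := (cos t +i* sin t)%C.

Lemma conjcM (z w : R[i]) : conjc (z * w) = conjc z * conjc w.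
Proof. exact: rmorphM. Qed.

Lemma cisD s t : cis (s + t) = cis s * cis t.
Proof. by rewrite /cis cosD sinD; simpc; congr (_ +i* _)%C; ring. Qed.

Lemma conjc_cis t : conjc (cis t) = cis (- t).
Proof. by rewrite /cis cosN sinN. Qed.

Lemma sqn1_cis (z : R[i]) : sqn z = 1 -> exists t, z = cis t.
Proof.
case: z => x y; rewrite /sqn /= => xy1.
have xI : -1 <= x <= 1 by have := sqr_ge0 y; nra.
have y2 : y ^+ 2 = 1 - x ^+ 2 by lra.
have sE : sin (acos x) = `|y| by rewrite sin_acos // -y2 sqrtr_sqr.
have cE : cos (acos x) = x by rewrite acosK // in_itv.
(* The arc cosine recovers the angle up to sign, and the sign of [y] decides which. *)
have [y0|y0] := leP 0 y.
  by exists (acos x); rewrite /cis cE sE ger0_norm.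
by exists (- acos x); rewrite /cis cosN sinN cE sE ltr0_norm ?opprK.
Qed.

Lemma same_sqn_cis (z w : R[i]) : 0 < sqn z -> sqn w = sqn z ->
  exists t, w = cis t * z.
Proof.
move=> z0 wz; have zn0 : z != 0.
  by apply: contraTneq z0 => ->; rewrite /sqn /= !expr0n addr0 ltxx.
have [|t wt] := @sqn1_cis (w / z); last by exists t; rewrite -wt divfK.
by apply: (mulIf (lt0r_neq0 z0)); rewrite -sqnM divfK // mul1r.
Qed.

Lemma expi_qmul t (q : quat R) :
  expi t * q = Quat (cis t * qfst q) (cis t * qsnd q).
Proof. by rewrite qmulE /= !mul0r subr0 addr0. Qed.

Lemma qmul_expi t (q : quat R) :
  q * expi t = Quat (qfst q * cis t) (qsnd q * cis (- t)).
Proof.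
case: q => [[? ?] [? ?]]; rewrite qmulE /cis cosN sinN /=.
by apply: quat_eq; ring.
Qed.

Lemma nu_piE (p : Sp2 R) : nu (\pi_(CP3 R) p) = nuq (p 0 0) (p 1 0).
Proof. by rewrite nu_pi nu_Sp2E. Qed.

Lemma nu_act t s (x : CP3 R) : nu (CP3_act (torus t s) x) = nu x.
Proof.
elim/quotW: x => p; rewrite CP3_act_pi !nu_piE /= !mulmx2E !mxE /=.
rewrite !(mul0r, add0r, addr0) /nuq /phase !expi_qmul /=.
rewrite !conjcM !conjc_cis; congr (12 * complex.Im _).
have ct : cis (- t) * cis t = 1 by rewrite -cisD addNr /cis cos0 sin0.
have cs : cis s * cis (- s) = 1 by rewrite -cisD subrr /cis cos0 sin0.
rewrite (mulrACA (cis (- t))) ct (mulrACA (cis s)) cs.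
by rewrite !mul1r.
Qed.

(** A coset is determined by its first column up to a right phase: the first column of p^* q is
    (e^(it), 0), and unitarity then makes this matrix diagonal with a unit quaternion in the other
    corner. *)
Lemma same_first_column (p q : Sp2 R) t :
  q 0 0 = p 0 0 * expi t -> q 1 0 = p 1 0 * expi t -> same_coset p q.
Proof.
move=> q0 q1; apply/asboolP; pose h := conjtr p *m q.
have qE : sp2mx q = sp2mx p *m h by rewrite mulmxA sp2_mulV mul1mx.
exists h => //.
have hV : conjtr h *m h = 1%:M.
  by rewrite conjtrM conjtrK -mulmxA (mulmxA (sp2mx p)) sp2_mulV mul1mx sp2_mulVl.
have pI i : (conjtr p *m p) i 0 = (1%:M : 'M[quat R]_2) i 0 by rewrite sp2_mulVl.
have h0 i : h i 0 = (1%:M : 'M[quat R]_2) i 0 * expi t.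
  by rewrite /h mulmx2E q0 q1 !mulrA -mulrDl -pI mulmx2E.
have h00 : h 0 0 = expi t by rewrite h0 mxE /= mul1r.
have h10 : h 1 0 = 0 by rewrite h0 mxE /= mul0r.
clearbody h; have h01 : h 0 1 = 0.
  move: hV => /matrixP/(_ 0 1); rewrite mulmx2E !mxE /= h00 h10 qconj0 mul0r addr0.
  move=> /(congr1 (fun q => expi t * q)).
  by rewrite mulr0 mulrA qconj_expi -expiD subrr expi0 mul1r.
exists t, (h 1 1); split; last by rewrite {1}(mat2_eta h) h00 h10 h01.
move: hV => /matrixP/(_ 1 1); rewrite mulmx2E !mxE /= h01.
by rewrite qconj0 mul0r add0r.
Qed.

Lemma extremal_orbit (p q : Sp2 R) :
  extremal (p 0 0) (p 1 0) -> extremal (q 0 0) (q 1 0) ->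
  nuq (p 0 0) (p 1 0) = nuq (q 0 0) (q 1 0) ->
  exists u : R * R, CP3_act (torus u.1 u.2) (\pi_(CP3 R) p) = \pi_(CP3 R) q.
Proof.
move=> [[p1 p2 p3 p4] pr] [[q1 q2 q3 q4] qr] pq.
have ph : phase (p 0 0) (p 1 0) = phase (q 0 0) (q 1 0).
  move: pr qr pq; rewrite /nuq.
  case: (phase _ _) (phase _ _) => [x1 x2] [y1 y2] /= -> -> h.
  by congr (_ +i* _)%C; lra.
have [al1 e1] : exists t, qfst (q 0 0) = cis t * qfst (p 0 0).
  by apply: same_sqn_cis; rewrite ?p1 ?q1.
have [al2 e2] : exists t, qsnd (q 0 0) = cis t * qsnd (p 0 0).
  by apply: same_sqn_cis; rewrite ?p2 ?q2.
have [al3 e3] : exists t, qfst (q 1 0) = cis t * qfst (p 1 0).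
  by apply: same_sqn_cis; rewrite ?p3 ?q3.
(* The torus element ([vt], [ps]) on the left and the phase [th] on the right must satisfy vt + th =
   al1, vt - th = al2 and ps + th = al3. These equations determine all three angles. *)
pose th := (al1 - al2) / 2; pose vt := (al1 + al2) / 2; pose ps := al3 - th.
(* No freedom is left for the fourth entry; its phase is forced by the equality of the two
   monomials, whose other three factors are nonzero. *)
have e4 : qsnd (q 1 0) = cis (ps - th) * qsnd (p 1 0).
  have c0 : 0 < sqn (conjc (qfst (p 0 0)) * qsnd (p 0 0) * qfst (p 1 0)).
    by rewrite !sqnM sqn_conjc p1 p2 p3 !mulr_gt0.
  have n0 : conjc (qfst (p 0 0)) * qsnd (p 0 0) * qfst (p 1 0) != 0.
    by apply: contraTneq c0 => ->; rewrite /sqn /= !expr0n addr0 ltxx.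
  have h : cis (ps - th) * conjc (qsnd (q 1 0)) = conjc (qsnd (p 1 0)).
    have -> : ps - th = - al1 + al2 + al3 by rewrite /ps /th; field.
    apply: (mulfI n0); rewrite -[RHS]mulrA -/(phase _ _) ph /phase e1 e2 e3.
    by rewrite conjcM conjc_cis !cisD; ring.
  apply: (can_inj (@conjcK R)); rewrite conjcM conjc_cis -h mulrA -cisD addNr.
  by rewrite /cis cos0 sin0 mul1r.
exists (vt, ps).
rewrite CP3_act_pi; apply/eqquotP; apply: (@same_first_column _ _ th).
  rewrite /= mulmx2E !mxE /= mul0r addr0 expi_qmul qmul_expi /=.
  rewrite mulrAC -cisD mulrAC -cisD.
  have -> : vt + th = al1 by rewrite /vt /th; field.
  have -> : vt - th = al2 by rewrite /vt /th; field.
  by rewrite -e1 -e2; case: (q 0 0).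
rewrite /= mulmx2E !mxE /= mul0r add0r expi_qmul qmul_expi /=.
rewrite mulrAC -cisD mulrAC -cisD.
have -> : ps + th = al3 by rewrite /ps; ring.
by rewrite -e3 -e4; case: (q 1 0).
Qed.

(** * Extremal values: criticality, level sets and existence *)

Lemma nu_bound (x : CP3 R) : - (3 / 4) <= nu x <= 3 / 4.
Proof. by elim/quotW: x => p; rewrite nu_piE nuq_bound // colnorm_sp2. Qed.

Lemma derivable_nu_curve (c : R -> Sp2 R) t : derivable_curve c ->
  derivable (fun s => nu (\pi_(CP3 R) (c s))) t (1 : R).
Proof.
move=> dc.
have dq i j : exists q', is_qderive (fun s => c s i j) t q'.
  case: (dc t i j) => /derivableP d1 /derivableP d2 /derivableP d3 /derivableP d4.
  by exists (Quat ('D_1 (fun s => complex.Re (qfst (c s i j))) t +i*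
                   'D_1 (fun s => complex.Im (qfst (c s i j))) t)%C
                  ('D_1 (fun s => complex.Re (qsnd (c s i j))) t +i*
                   'D_1 (fun s => complex.Im (qsnd (c s i j))) t)%C).
have [u' du] := dq 0 0; have [v' dv] := dq 1 0.
have -> : (fun s => nu (\pi_(CP3 R) (c s))) = (fun s => nuq (c s 0 0) (c s 1 0)).
  by apply/funext => s; rewrite nu_piE.
by case: (is_derive_nuq du dv).
Qed.

(** Fermat's rule along each curve through [x]: by the global bound [nu_bound], nu on the curve has
    an interior extremum at parameter 0. *)
Lemma critical_extremum (x : CP3 R) :
  nu x = 3 / 4 \/ nu x = - (3 / 4) -> critical x.
Proof.
move=> nx c dc c0.
have I0 : (0 : R) \in `](-1), 1[%R by rewrite in_itv /= ltrN10 ltr01.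
have le11 : -1 <= 1 :> R by lra.
case: nx => nx; [apply: (derive1_at_max le11 _ I0) => s _
  | apply: (derive1_at_min le11 _ I0) => s _]; rewrite ?c0 ?nx;
  by [exact: derivable_nu_curve | case/andP: (nu_bound (\pi_(CP3 R) (c s)))].
Qed.

Lemma critical_nu (x : CP3 R) : critical x -> nu x <> 0 ->
  nu x = 3 / 4 \/ nu x = - (3 / 4).
Proof.
elim/quotW: x => p crit; rewrite nu_piE => /eqP n0.
by apply/(nuq_extremal (colnorm_sp2 p))/critical_extremal.
Qed.

Lemma T2orbit_extremum (x : CP3 R) : nu x = 3 / 4 \/ nu x = - (3 / 4) ->
  T2orbit x = [set y | nu y = nu x].
Proof.
move=> nx; apply/seteqP; split=> y /=.
  by case=> [[t s] _ <-] /=; rewrite nu_act.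
elim/quotW: x nx => p; elim/quotW: y => q; rewrite !nu_piE => nx qp.
have ex (r : Sp2 R) : nuq (r 0 0) (r 1 0) = nuq (p 0 0) (p 1 0) ->
    extremal (r 0 0) (r 1 0).
  by move=> e; apply/(nuq_extremal (colnorm_sp2 r)); rewrite e.
have [u uE] := extremal_orbit (ex p erefl) (ex q qp) (esym qp).
by exists u.
Qed.

(** When both quaternions have squared norm 1/2, flipping one sign in a copy of the first column
    gives an orthonormal second column. *)
Lemma sp2_of_first_column (a c : quat R) :
  a * qconj a = qreal 2^-1 -> qconj a * a = qreal 2^-1 ->
  c * qconj c = qreal 2^-1 -> qconj c * c = qreal 2^-1 ->
  is_Sp2 (mat2 a a c (- c)).
Proof.
have half : qreal 2^-1 + qreal 2^-1 = 1 :> quat R.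
  by rewrite -qrealD (_ : 2^-1 + 2^-1 = 1) //; field.
move=> a1 a2 c1 c2; rewrite /is_Sp2 conjtr_mat2 !mul_mat2 mat2_1 qconjN.
rewrite !(mulNr, mulrN) !opprK a1 a2 c1 c2 half !subrr.
by rewrite !eqxx.
Qed.

Lemma nu_extremum_exists (e : R) : e ^+ 2 = 1 -> exists x : CP3 R, nu x = e * (3 / 4).
Proof.
(* All four components have modulus 1/2, and conj(c2) = i e/2 makes m equal to i e/16, so nu is 12
   e/16. *)
move=> e1; pose a : quat R := Quat (2^-1 +i* 0)%C (2^-1 +i* 0)%C.
pose c : quat R := Quat (2^-1 +i* 0)%C (0 -i* (e / 2))%C.
have e1' : e * e = 1 by rewrite -expr2.
have pP : is_Sp2 (mat2 a a c (- c)).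
  apply: sp2_of_first_column; rewrite /qconj /qreal qmulE /=;
    by apply: quat_eq; field: e1'.
exists (\pi_(CP3 R) (MkSp2 pP)); rewrite nu_piE !mxE /= /nuq /phase /=.
by field.
Qed.

End MultiMoment.

Theorem proposition5p3 (R : realType) :
  exists Omax Omin : set (CP3 R),
    [/\ Omax <> Omin,
        [set T2orbit x | x in [set x : CP3 R | critical x /\ nu x <> 0]]
          = [set Omax; Omin],
        (forall x y : CP3 R, Omax x -> nu y <= nu x) &
        (forall x y : CP3 R, Omin x -> nu x <= nu y)].
Proof.
have n0 : (3 / 4 : R) <> 0 by lra.
have nN0 : - (3 / 4 : R) <> 0 by lra.
have nN : (3 / 4 : R) <> - (3 / 4) by lra.
have [xM] := @nu_extremum_exists R 1 (expr1n _ _); rewrite mul1r => nM.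
have [xm] := @nu_extremum_exists R (-1) (etrans (sqrrN _) (expr1n _ _)).
rewrite mulN1r => nm.
(* The two orbits are given as level sets of nu, so that extremality follows from the bound;
   [T2orbit_extremum] identifies them with orbits, and the points [xM] and [xm] show that both
   occur. *)
exists [set x | nu x = 3 / 4], [set x | nu x = - (3 / 4)]; split.
- move/seteqP => [/(_ xM nM) /=]; rewrite nM => /nN[].
- apply/seteqP; split=> [S [x [crit nx0] <-]|S [->|->] /=].
  + have nx := critical_nu crit nx0; rewrite (T2orbit_extremum nx).
    by case: nx => ->; [left|right].
  + exists xM; last by rewrite T2orbit_extremum nM //; left.
    by split; [apply: critical_extremum; left | rewrite nM].
  + exists xm; last by rewrite T2orbit_extremum nm //; right.
    by split; [apply: critical_extremum; right | rewrite nm].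
- by move=> x y /= ->; case/andP: (nu_bound y).
- by move=> x y /= ->; case/andP: (nu_bound y).
Qed.
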